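(* Let $(A,\rhd,\lhd)$ be a Leibniz-dendriform algebra. Then the binary operation $[\cdot,\cdot]_{\rhd,\lhd}:A\otimes A\to A$ given by $[x,y]_{\rhd,\lhd}=x\lhd y+x\rhd y$ for all $x,y\in A$ makes $A$ a Leibniz algebra.
   Context: All vector spaces are finite-dimensional over an algebraically closed field $\mathbb K$ of characteristic $0$. A Leibniz algebra is a vector space with a bilinear operation satisfying $[x,[y,z]]=[[x,y],z]+[y,[x,z]]$. A Leibniz-dendriform algebra is a vector space $A$ with two bilinear operations $\rhd,\lhd:A\otimes A\to A$ such that for all $x,y,z\in A$: $(x\lhd y)\lhd z=x\lhd(y\lhd z)-y\lhd(x\lhd z)-(x\rhd y)\lhd z$; $x\lhd(y\rhd z)=(x\lhd y)\rhd z+y\rhd(x\lhd z)+y\rhd(x\rhd z)$; $x\rhd(y\rhd z)=(x\rhd y)\rhd z+y\lhd(x\rhd z)-x\rhd(y\lhd z)$. *)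

(* Defs.v *)
From mathcomp Require Import all_boot all_algebra.

Set Implicit Arguments.
Unset Strict Implicit.
Unset Printing Implicit Defensive.

Import GRing.Theory.
Local Open Scope ring_scope.

Section Definitions.

Context (K : fieldType) (A : vectType K).

(* This is the left version: each left multiplication is a derivation. *)
Record leibniz_algebra (br : A -> A -> A) : Prop := LeibnizAlgebra {
  leibniz_bilinear : bilinear_for *:%R *:%R br;
  leibniz_identity : forall x y z : A,
    br x (br y z) = br (br x y) z + br y (br x z)
}.

Section Dendriform.

Context (rhd lhd : A -> A -> A).

Local Notation "x ▷ y" := (rhd x y) (at level 35, no associativity).
Local Notation "x ◁ y" := (lhd x y) (at level 35, no associativity).

Record leibniz_dendriform : Prop := LeibnizDendriform {
  dendriform_rhd_bilinear : bilinear_for *:%R *:%R rhd;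
  dendriform_lhd_bilinear : bilinear_for *:%R *:%R lhd;
  dendriform_lhd_lhd : forall x y z : A,
    (x ◁ y) ◁ z = x ◁ (y ◁ z) - y ◁ (x ◁ z) - (x ▷ y) ◁ z;
  dendriform_lhd_rhd : forall x y z : A,
    x ◁ (y ▷ z) = (x ◁ y) ▷ z + y ▷ (x ◁ z) + y ▷ (x ▷ z);
  dendriform_rhd_rhd : forall x y z : A,
    x ▷ (y ▷ z) = (x ▷ y) ▷ z + y ◁ (x ▷ z) - x ▷ (y ◁ z)
}.

Definition dendriform_bracket (x y : A) : A := x ◁ y + x ▷ y.

End Dendriform.

End Definitions.

(* Main.v *)
Require Import Defs.
From mathcomp Require Import all_boot all_algebra.
Import GRing.Theory.
Local Open Scope ring_scope.

(** Write [[x,y]] for the bracket. By bilinearity the three axioms regroup as [x ◁ (y ◁ z) = [x,y] ◁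
    z + y ◁ (x ◁ z)], [x ◁ (y ▷ z) = (x ◁ y) ▷ z + y ▷ [x,z]] and [x ▷ [y,z] = (x ▷ y) ▷ z + y ◁ (x
    ▷ z)]. Their sum is the Leibniz identity. *)

Theorem proposition5p4 (K : closedFieldType) (charK0 : [pchar K] =i pred0)
    (A : vectType K) (rhd lhd : A -> A -> A)
    (dendA : leibniz_dendriform rhd lhd) :
  leibniz_algebra (dendriform_bracket rhd lhd).
Proof.
case: dendA => -[rhdl rhdr] [lhdl lhdr] lhd_lhd lhd_rhd rhd_rhd.
have linD (f : A -> A) (Lf : linear_for *:%R f) u v : f (u + v) = f u + f v.
  by have := Lf 1 u v; rewrite !scale1r.
have rhdDl z : {morph rhd^~ z : u v / u + v} := linD _ (rhdl z).
have rhdDr x : {morph rhd x : u v / u + v} := linD _ (rhdr x).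
have lhdDl z : {morph lhd^~ z : u v / u + v} := linD _ (lhdl z).
have lhdDr x : {morph lhd x : u v / u + v} := linD _ (lhdr x).
split; first by split=> w a u v; rewrite /dendriform_bracket /=
  ?rhdl ?lhdl ?rhdr ?lhdr scalerDr addrACA.
move=> x y z; rewrite /dendriform_bracket.
(* [rhd_rhd] gets its arguments because [y ▷ (x ▷ z)] matches too and must stay as it is. *)
rewrite !(rhdDl, rhdDr, lhdDl, lhdDr) lhd_lhd subrK lhd_rhd (rhd_rhd x y z).
rewrite (addrC (rhd x (lhd y z))) subrK -!addrA; congr (_ + _).
(* The two swaps bring [y ◁ (x ◁ z)] next to its opposite, which came from [lhd_lhd]. *)
rewrite [X in _ = _ + (_ + X)]addrCA [X in _ = _ + X]addrCA addKr.
by congr (_ + _); rewrite addrA addrC -addrA.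
Qed.
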